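(* Let $\Omega\subset\mathbb{R}$ be a bounded open interval, $b\in\mathbb{R}\setminus\{0\}$ constant, $f\in L_2(\Omega)$, and $\mathcal{T}_h$ a mesh of $\Omega$. Let $u_h$ be the discrete solution given by any one of the following methods: (PG1) with $k\ge 2$: $u_h\in H^1_-(\Omega)\cap\mathcal{P}^k(\mathcal{T}_h)$ such that $(b\nabla u_h,v_h)=(f,v_h)$ for all $v_h\in\mathcal{P}^{k-1}(\mathcal{T}_h)$; (PG2) with $k\ge 0$: $u_h\in\mathcal{P}^k(\mathcal{T}_h)$ such that $-(u_h,b\nabla v_h)=(f,v_h)$ for all $v_h\in H^1_+(\Omega)\cap\mathcal{P}^{k+1}(\mathcal{T}_h)$; (dG) with $k\ge 1$: $u_h\in\mathcal{P}^k(\mathcal{T}_h)$ such that $\mathcal{B}_h(u_h,v_h)=(f,v_h)$ for all $v_h\in\mathcal{P}^k(\mathcal{T}_h)$, where $$\mathcal{B}_h(u_h,v_h)=-\sum_{K\in\mathcal{T}_h}(u_h,b\nabla v_h)_K-\sum_{e\in\mathcal{V}_h^{\mathrm{int}}}(b\,n)\,\{\!\{u_h\}\!\}[\![v_h]\!]+\sum_{e\in\mathcal{V}_h^{\mathrm{int}}}\tfrac12|b\,n|\,[\![u_h]\!][\![v_h]\!]+\sum_{e\in\mathcal{V}_h^{\mathrm{bnd}}}(b\,n)^+u_hv_h .$$ Then the $\psi_a$-orthogonality of the residual holds true: $$\langle\mathcal{R}(u_h),\psi_a\rangle=(f,\psi_a)_{\omega_a}+(u_h,b\nabla\psi_a)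_{\omega_a}=0\qquad\forall\,a\in\mathcal{V}_h^{\mathrm{int}}\cup\mathcal{V}_h^{\partial_-\Omega}.$$
   Context: Notation: $(v,w)_D=\int_D vw$, with the subscript dropped when $D=\Omega$; $\nabla v=v'$ (elementwise where needed). With $n=\pm1$ the outward unit normal at the endpoints of $\Omega$, $\partial_\pm\Omega=\{x\in\partial\Omega:\pm b\,n(x)>0\}$ ($-$ inflow, $+$ outflow) and $H^1_\pm(\Omega)=\{w\in H^1(\Omega): w=0\text{ on }\partial_\pm\Omega\}$. The residual of $u_h\in L_2(\Omega)$ is $\langle\mathcal{R}(u_h),v\rangle=(f,v)+(u_h,b\nabla v)$ for $v\in H^1_+(\Omega)$. Mesh: $\mathcal{T}_h$ is a finite division of $\Omega$ into non-overlapping intervals covering $\Omega$, shape regular in the sense that any two neighboring intervals have comparable lengths up to a constant $\kappa_{\mathcal{T}_h}$. The mesh vertices are split into interior vertices $\mathcal{V}_h^{\mathrm{int}}$, inflow vertices $\mathcal{V}_h^{\partial_-\Omega}$ and outflow vertices $\mathcal{V}_h^{\partial_+\Omega}$; $\mathcal{V}_h^{\mathrm{bnd}}=\mathcal{V}_h^{\partial_-\Omega}\cup\mathcal{V}_h^{\partial_+\Omega}$. $\mathcal{P}^k(\mathcal{T}_h)$ is the space of piecewise polynomials of degree at most $k$ on $\mathcal{T}_h$ (no continuity imposed). For a vertex $a$, $\omega_a$ is the open interval formed by the elements having $a$ as a vertex, and $\psi_a$ is the continuous piecewise affine hat function equal to $1$ at $a$ and $0$ at all other vertices. At an interior vertex,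 $v^-$ and $v^+$ are the traces from the left and from the right, $\{\!\{v\}\!\}=(v^-+v^+)/2$, $[\![v]\!]=v^+-v^-$, and the unit normal is $n=1$ (pointing from left to right); at the boundary vertices $n$ is the outward normal. $(x)^+=\max(x,0)$. *)

(* Defs.v *)
From HB Require Import structures.
From mathcomp Require Import all_boot all_order all_algebra.
From mathcomp Require Import all_classical all_reals all_analysis.

Set Implicit Arguments.
Unset Strict Implicit.
Unset Printing Implicit Defensive.

Import Order.TTheory GRing.Theory Num.Theory.
Import numFieldNormedType.Exports.

Local Open Scope classical_set_scope.
Local Open Scope ring_scope.

Section Domain.
Context {R : realType}.
Implicit Types (D : set R) (v w : R -> R).

Definition L2prod D v w : R := \int[lebesgue_measure]_(x in D) (v x * w x).

(* The classical derivative. Piecewise polynomials are differentiable off the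
   finitely many vertices, so under an integral this is the elementwise
   derivative. *)
Definition grad v : R -> R := derive1 v.

Definition L2 D v : Prop := (v \_ D) \in Lfun (@lebesgue_measure R) 2%:E.

(* Test functions of class C^1 (rather than C^oo) with compact support in D;
   on an interval both choices give the same space H^1 (Brezis, Section 8.2). *)
Definition C1c D (phi : R -> R) : Prop :=
  [/\ forall x, derivable phi x 1,
      continuous (derive1 phi),
      compact (closure [set x | phi x != 0]) &
      closure [set x | phi x != 0] `<=` D].

Definition weak_derivative D w (g : R -> R) : Prop :=
  forall phi, C1c D phi -> L2prod D w (grad phi) = - L2prod D g phi.

Definition H1 D w : Prop :=
  L2 D w /\ exists2 g, L2 D g & weak_derivative D w g.

(* Functions are only determined almost everywhere on D: the boundary values of
   w are those of its representative that is continuous up to the boundary. *)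
Definition H1_vanishing_on D (B : set R) w : Prop :=
  H1 D w /\
  exists wc : R -> R,
    [/\ {within closure D, continuous wc},
        {ae lebesgue_measure, forall x, D x -> w x = wc x} &
        forall c, B c -> wc c = 0].

Definition Omega (xl xr : R) : set R := `]xl, xr[%classic.

(* Unit normal: outward at the two endpoints xl and xr, and 1 at the points in
   between. *)
Definition unit_normal (xl x : R) : R := if x == xl then -1 else 1.

Definition inflow (xl xr b : R) : set R :=
  [set x | (x = xl \/ x = xr) /\ b * unit_normal xl x < 0].

Definition outflow (xl xr b : R) : set R :=
  [set x | (x = xl \/ x = xr) /\ 0 < b * unit_normal xl x].

Definition H1m (xl xr b : R) w : Prop :=
  H1_vanishing_on (Omega xl xr) (inflow xl xr b) w.

Definition H1p (xl xr b : R) w : Prop :=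
  H1_vanishing_on (Omega xl xr) (outflow xl xr b) w.

Definition residual (xl xr b : R) (f u v : R -> R) : R :=
  L2prod (Omega xl xr) f v + L2prod (Omega xl xr) u (fun x => b * grad v x).

Definition trace_left v (x : R) : R := lim (v y @[y --> x^'-]).
Definition trace_right v (x : R) : R := lim (v y @[y --> x^'+]).
Definition average v (x : R) : R := (trace_left v x + trace_right v x) / 2.
Definition jump v (x : R) : R := trace_right v x - trace_left v x.

Definition trace_bnd (xl : R) v (x : R) : R :=
  if x == xl then trace_right v x else trace_left v x.

End Domain.

(* A mesh with N elements has the vertices xl = x_0 < x_1 < ... < x_N = xr; the
   list nodes is x_1, ..., x_N. Vertices are referred to by their index i <= N
   and elements by their index i < N. *)
Record mesh (R : realType) (xl xr kappa : R) := Mesh {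
  nodes : seq R;
  nodes_partition : itv_partition xl xr nodes;
  nodes_shape_regular : forall i, (i.+1 < size nodes)%N ->
    let x j := nth 0 (xl :: nodes) j in
    x i.+1 - x i <= kappa * (x i.+2 - x i.+1) /\
    x i.+2 - x i.+1 <= kappa * (x i.+1 - x i) }.

Section Discretization.
Context {R : realType} {xl xr kappa : R} (T : mesh xl xr kappa).
Implicit Types (f u v : R -> R) (b : R) (k i : nat).

Definition ncell : nat := size (nodes T).
Definition vertex i : R := nth 0 (xl :: nodes T) i.
Definition cell i : set R := `]vertex i, vertex i.+1[%classic.

Definition Vint i : Prop := (0 < i < ncell)%N.
Definition Vin b i : Prop := (i <= ncell)%N /\ inflow xl xr b (vertex i).
Definition Vout b i : Prop := (i <= ncell)%N /\ outflow xl xr b (vertex i).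

(* The values at the vertices are left arbitrary. *)
Definition Ppw k v : Prop :=
  forall i, (i < ncell)%N ->
    exists2 p : {poly R}, (size p <= k.+1)%N &
      forall x, cell i x -> v x = p.[x].

(* At the boundary vertices the truncations leave a single element. *)
Definition vertex_patch i : set R :=
  `]vertex i.-1, vertex (minn i.+1 ncell)[%classic.

Definition is_hat i (psi : R -> R) : Prop :=
  [/\ {within `[xl, xr], continuous psi},
      Ppw 1 psi &
      forall j, (j <= ncell)%N -> psi (vertex j) = (j == i)%:R].

Lemma vertex_lt i j : (i < j <= ncell)%N -> vertex i < vertex j.
Proof.
have [sT _] := nodes_partition T.
case/andP=> ij jN; apply: (sorted_ltn_nth lt_trans) => //.
by rewrite inE /= ltnS (leq_trans (ltnW ij)).
Qed.

Lemma hat_exists i : (i <= ncell)%N -> exists psi, is_hat i psi.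
Proof.
move=> iN.
pose l := vertex i.-1; pose c := vertex i; pose r := vertex (minn i.+1 ncell).
pose A (x : R) := (c - x) / (c - l); pose B (x : R) := (x - c) / (r - c).
pose psi (x : R) := Num.max 0 (1 - Num.max 0 (A x) - Num.max 0 (B x)).
have vle m n : (m <= n <= ncell)%N -> vertex m <= vertex n.
  case/andP; rewrite leq_eqVlt => /orP[/eqP-> //|mn nN].
  by rewrite ltW// vertex_lt// mn.
have lc : l <= c by apply: vle; rewrite leq_pred.
have cr : c <= r by apply: vle; rewrite geq_minr leq_min leqnSn iN.
have A_le0 x : c <= x -> A x <= 0.
  by move=> cx; rewrite mulr_le0_ge0 ?subr_le0// invr_ge0 subr_ge0.
have B_le0 x : x <= c -> B x <= 0.
  by move=> cx; rewrite mulr_le0_ge0 ?subr_le0// invr_ge0 subr_ge0.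
have psiL x : x <= c -> psi x = Num.max 0 (1 - Num.max 0 (A x)).
  by move=> xc; rewrite /psi (max_l (B_le0 _ xc)) subr0.
have psiR x : c <= x -> psi x = Num.max 0 (1 - Num.max 0 (B x)).
  by move=> xc; rewrite /psi (max_l (A_le0 _ xc)) subr0.
have psi0L x : l < c -> x <= l -> psi x = 0.
  move=> lc' xl'; rewrite psiL ?(le_trans xl')//; apply: max_l.
  rewrite subr_le0 le_max; apply/orP; right.
  by rewrite /A ler_pdivlMr ?subr_gt0// mul1r lerD2l lerN2.
have psi0R x : c < r -> r <= x -> psi x = 0.
  move=> cr' rx; rewrite psiR ?(le_trans _ rx)//; apply: max_l.
  rewrite subr_le0 le_max; apply/orP; right.
  by rewrite /B ler_pdivlMr ?subr_gt0// mul1r lerD2r.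
have psi1L x : l < c -> l <= x -> x <= c -> psi x = 1 - A x.
  move=> lc' lx xc; rewrite psiL// (max_r (_ : 0 <= A x)); last first.
    by rewrite divr_ge0 ?subr_ge0.
  by rewrite max_r// subr_ge0 /A ler_pdivrMr ?subr_gt0// mul1r lerD2l lerN2.
have psi1R x : c < r -> c <= x -> x <= r -> psi x = 1 - B x.
  move=> cr' cx xr'; rewrite psiR// (max_r (_ : 0 <= B x)); last first.
    by rewrite divr_ge0 ?subr_ge0.
  by rewrite max_r// subr_ge0 /B ler_pdivrMr ?subr_gt0// mul1r lerD2r.
have ltl j : (j < i)%N -> l < c.
  by move=> ji; apply: vertex_lt; rewrite iN andbT; case: (i) ji.
have ltr j : (i < j <= ncell)%N -> c < r.
  case/andP=> ij jN; apply: vertex_lt.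
  by rewrite geq_minr leq_min ltnS leqnn (leq_trans ij).
exists psi; split.
- apply: continuous_subspaceT => x.
  have cA : continuous A.
    move=> y; apply: (@cvgM _ _ _ _ (fun x => c - x) (fun=> (c - l)^-1)).
      by apply: (@cvgB _ _ _ _ _ (fun=> c) id); [exact: cvg_cst|exact: cvg_id].
    exact: cvg_cst.
  have cB : continuous B.
    move=> y; apply: (@cvgM _ _ _ _ (fun x => x - c) (fun=> (r - c)^-1)).
      by apply: (@cvgB _ _ _ _ _ id (fun=> c)); [exact: cvg_id|exact: cvg_cst].
    exact: cvg_cst.
  have c0 : continuous ((fun=> 0) : R -> R) by move=> y; exact: cvg_cst.
  have cmA : continuous (fun y => Num.max 0 (A y)).
    by move=> y; exact: (@continuous_max R _ (fun=> 0) A y (c0 y) (cA y)).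
  have cmB : continuous (fun y => Num.max 0 (B y)).
    by move=> y; exact: (@continuous_max R _ (fun=> 0) B y (c0 y) (cB y)).
  have cM : continuous (fun y => 1 - Num.max 0 (A y) - Num.max 0 (B y)).
    move=> y; apply: cvgB (cmB y); apply: cvgB (cmA y); exact: cvg_cst.
  exact: (@continuous_max R _ (fun=> 0) _ x (c0 x) (cM x)).
- move=> j jN; have [ji|ij] := ltnP j i.
    have lc' := ltl _ ji; have [ji'|] := ltnP j.+1 i.
      exists 0; first by rewrite size_poly0.
      move=> x; rewrite /cell /= in_itv/= => /andP[_ xj]; rewrite horner0.
      apply: psi0L => //; apply: (le_trans (ltW xj)); apply: vle.
      by case: (i) ji' iN => //= n; rewrite ltnS => -> /ltnW ->.
    move=> ij; have ij' : i = j.+1 by apply/eqP; rewrite eqn_leq ij.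
    exists ((1 - c / (c - l))%:P + (c - l)^-1 *: 'X).
      rewrite (leq_trans (size_polyD _ _))// geq_max.
      rewrite (leq_trans (size_polyC_leq1 _))//=.
      by rewrite (leq_trans (size_scale_leq _ _))// size_polyX.
    move=> x; rewrite /cell /= in_itv/= => /andP[jx xj].
    rewrite psi1L// ?ltW//; last 2 first.
    + by rewrite /l ij'.
    + by rewrite /c ij'.
    by rewrite !hornerE /A mulrBl opprB addrA addrAC [x / _]mulrC.
  have cr' : c < r by apply: (ltr j.+1); rewrite ltnS ij.
  have rE : r = vertex i.+1.
    by rewrite /r (minn_idPl _)// (leq_ltn_trans ij).
  move: ij; rewrite leq_eqVlt => /orP[/eqP ij|ij].
    exists ((1 + c / (r - c))%:P - (r - c)^-1 *: 'X).
      rewrite (leq_trans (size_polyD _ _))// geq_max.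
      rewrite (leq_trans (size_polyC_leq1 _))//= size_polyN.
      by rewrite (leq_trans (size_scale_leq _ _))// size_polyX.
    move=> x; rewrite /cell /= in_itv/= -ij => /andP[jx xj].
    rewrite psi1R// ?ltW// ?rE//.
    by rewrite !hornerE /B -rE mulrBl opprB addrA [x / _]mulrC.
  exists 0; first by rewrite size_poly0.
  move=> x; rewrite /cell /= in_itv/= => /andP[jx _]; rewrite horner0.
  apply: psi0R => //; apply: (le_trans _ (ltW jx)).
  by rewrite rE; apply: vle; rewrite ij ltnW.
- move=> j jN; have [ji|ij|->] := ltngtP j i.
  + apply: psi0L; first exact: ltl ji.
    by apply: vle; case: (i) ji iN => //= n; rewrite ltnS => -> /ltnW ->.
  + apply: psi0R; first by apply: (ltr j); rewrite ij.
    by apply: vle; rewrite jN andbT (leq_trans _ ij)// geq_minl.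
  + by rewrite psiL// /A -/c subrr mul0r maxxx subr0 max_r.
Qed.

Definition PG1 k b f u : Prop :=
  [/\ H1m xl xr b u, Ppw k u &
      forall v, Ppw k.-1 v ->
        L2prod (Omega xl xr) (fun x => b * grad u x) v
        = L2prod (Omega xl xr) f v].

Definition PG2 k b f u : Prop :=
  Ppw k u /\
  forall v, H1p xl xr b v -> Ppw k.+1 v ->
    - L2prod (Omega xl xr) u (fun x => b * grad v x)
    = L2prod (Omega xl xr) f v.

Definition Bh b u v : R :=
  - (\sum_(i < ncell) L2prod (cell i) u (fun x => b * grad v x))
  - (\sum_(i < ncell.+1 | `[< Vint i >])
       b * unit_normal xl (vertex i) * average u (vertex i) * jump v (vertex i))
  + (\sum_(i < ncell.+1 | `[< Vint i >])
       2^-1 * `|b * unit_normal xl (vertex i)|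
       * jump u (vertex i) * jump v (vertex i))
  + (\sum_(i < ncell.+1 | `[< Vin b i \/ Vout b i >])
       Num.max (b * unit_normal xl (vertex i)) 0
       * trace_bnd xl u (vertex i) * trace_bnd xl v (vertex i)).

Definition dG k b f u : Prop :=
  Ppw k u /\
  forall v, Ppw k v -> Bh b u v = L2prod (Omega xl xr) f v.

End Discretization.

(* Main.v *)
Require Import Defs.
From mathcomp Require Import all_boot all_order all_algebra.
From mathcomp Require Import all_classical all_reals all_analysis.
From mathcomp Require Import measurable_realfun.
Import Order.TTheory GRing.Theory Num.Theory.
Import numFieldNormedType.Exports.
Local Open Scope classical_set_scope.
Local Open Scope ring_scope.

(** Why the residual is orthogonal to the hat functions: the hat function psi of
a vertex that is not an outflow vertex is an admissible test function of all
three methods, and each of their equations, tested with psi, is the identity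
(u, b psi') = - (f, psi), because all the boundary and interface terms vanish.

For the second Petrov-Galerkin method this is immediate once psi is known to lie
in H^1 and to vanish on the outflow boundary ([hat_H1p]); its weak derivative is
the elementwise one, which is integration by parts against a test function.

For the discontinuous Galerkin method the interface terms carry the jump of psi,
which is 0 by continuity, and a boundary term is 0 either because the upwind
factor (b n)^+ is 0 (inflow) or because psi is 0 (outflow).

For the first Petrov-Galerkin method the equation reads (b u', psi) = (f, psi),
and integration by parts moves the derivative onto psi. The interface terms
cancel since u agrees almost everywhere with a continuous function; at each end
of the domain either u (inflow) or psi (outflow) is 0.

Both integrations by parts are instances of [L2prod_by_parts], for functions
that are C^1 on each cell and whose one-sided values at each vertex agree. It is
integration by parts on each cell followed by a telescoping sum. Finally psi,
being affine on each cell, vanishes on the cells that do not touch its vertex,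
so that the integrals over the domain reduce to the patch. *)

Set Implicit Arguments.
Unset Strict Implicit.
Unset Printing Implicit Defensive.

(** * Integrals and null sets on the line *)

Section Integrals.
Context {R : realType}.
Notation mu := (@lebesgue_measure R).

Lemma integrable_itv_oc (a b : R) (h : R -> R) :
  mu.-integrable `]a, b[ (EFin \o h) -> mu.-integrable `]a, b] (EFin \o h).
Proof.
move=> /integrableP[mh ih]; apply/integrableP; split.
  exact/emeasurable_fun_itv_bndo_bndcP.
rewrite -integral_itv_bndo_bndc//; exact: measurableT_comp.
Qed.

Lemma integrable_itv_cat (a b c : R) (h : R -> R) : a <= b -> b <= c ->
  mu.-integrable `]a, b] (EFin \o h) -> mu.-integrable `]b, c] (EFin \o h) ->
  mu.-integrable `]a, c] (EFin \o h).
Proof.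
move=> ab bc /integrableP[m1 i1] /integrableP[m2 i2].
rewrite (@itv_bndbnd_setU _ _ _ (BRight b)) ?bnd_simp//.
have mU : measurable_fun (`]a, b] `|` `]b, c]) (EFin \o h).
  exact/measurable_funU.
apply/integrableP; split => //.
rewrite ge0_integral_setU//; first exact: lte_add_pinfty.
- exact: measurableT_comp.
- apply/disj_setPS => y [/=]; rewrite 2!in_itv/= => /andP[_ yb] /andP[].
  by rewrite ltNge yb.
Qed.

Lemma continuous_integrable_itvoo (a b : R) (g : R -> R) :
  continuous g -> mu.-integrable `]a, b[ (EFin \o g).
Proof.
move=> cg; apply: (@integrableS _ _ _ mu `[a, b]%classic) => //.
  exact: subset_itv_oo_cc.
apply: continuous_compact_integrable; first exact: segment_compact.
exact: continuous_subspaceT.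
Qed.

Lemma ae_itv_exists (a b : R) (P : R -> Prop) : a < b ->
  {ae mu, forall x, P x} -> exists2 x, `]a, b[%classic x & P x.
Proof.
move=> ab aeP; apply: contrapT => noP.
have [A [mA A0 PA]] := aeP.
have : (mu `]a, b[ <= mu A)%E.
  apply: le_measure; rewrite ?inE//.
  by move=> x xab; apply: PA => /= Px; apply: noP; exists x.
have := lebesgue_measure_itv `]a, b[.
rewrite /= lte_fin ab A0 => ->; rewrite -EFinD lee_fin leNgt subr_gt0 ab.
by [].
Qed.

(** One-sided neighbourhoods are never negligible: two functions that agree
almost everywhere agree somewhere in each of them, hence have the same one-sided
limits. *)
Lemma ae_eq_right_limit (a b : R) (g h : R -> R) (s t : R) : a < b ->
  {ae mu, forall x, `]a, b[%classic x -> g x = h x} ->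
  g x @[x --> a^'+] --> s -> h x @[x --> a^'+] --> t -> s = t.
Proof.
move=> ab gh gs ht; apply/eqP; rewrite -subr_eq0; apply/negPn/negP => st.
have ght : g x - h x @[x --> a^'+] --> s - t by exact: cvgB gs ht.
have [e /= e0 He] := cvgr_neq0 _ ght st.
have ac : a < Num.min (a + e) b by rewrite lt_min ab ltrDl e0.
have [x] := ae_itv_exists ac gh.
rewrite /= in_itv/= lt_min => /andP[ax /andP[xe xb]].
rewrite in_itv/= ax xb => /(_ isT) ghx.
have : ball_ Num.norm a e x.
  by rewrite /= distrC ger0_norm ?subr_ge0 ?ltW// ltrBlDl.
by move=> /He /(_ ax); rewrite ghx subrr eqxx.
Qed.

Lemma ae_eq_left_limit (a b : R) (g h : R -> R) (s t : R) : a < b ->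
  {ae mu, forall x, `]a, b[%classic x -> g x = h x} ->
  g x @[x --> b^'-] --> s -> h x @[x --> b^'-] --> t -> s = t.
Proof.
move=> ab gh gs ht; apply/eqP; rewrite -subr_eq0; apply/negPn/negP => st.
have ght : g x - h x @[x --> b^'-] --> s - t by exact: cvgB gs ht.
have [e /= e0 He] := cvgr_neq0 _ ght st.
have ac : Num.max (b - e) a < b by rewrite gt_max ab gtrBl e0.
have [x] := ae_itv_exists ac gh.
rewrite /= in_itv/= gt_max => /andP[/andP[xe ax] xb].
rewrite in_itv/= ax xb => /(_ isT) ghx.
have : ball_ Num.norm b e x.
  by rewrite /= ger0_norm ?subr_ge0 ?ltW// ltrBlDr -ltrBlDl.
by move=> /He /(_ xb); rewrite ghx subrr eqxx.
Qed.

End Integrals.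

(** * Integration of piecewise continuous functions over a mesh *)

Section Mesh.
Context {R : realType} {xl xr kappa : R} (T : mesh xl xr kappa).
Notation mu := (@lebesgue_measure R).
Implicit Types (h v w : R -> R) (i j k : nat).

Lemma vertex0 : vertex T 0 = xl. Proof. by []. Qed.

Lemma vertex_ncell : vertex T (ncell T) = xr.
Proof.
have [_ /eqP lastT] := nodes_partition T; rewrite -[RHS]lastT.
by rewrite /vertex /ncell (last_nth 0).
Qed.

Lemma vertex_le i j : (i <= j <= ncell T)%N -> vertex T i <= vertex T j.
Proof.
case/andP; rewrite leq_eqVlt => /orP[/eqP-> //|ij jN].
by rewrite ltW// vertex_lt// ij.
Qed.

Lemma vertexS_lt i : (i < ncell T)%N -> vertex T i < vertex T i.+1.
Proof. by move=> iN; rewrite vertex_lt// ltnSn. Qed.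

Lemma vertex_bounds i : (i <= ncell T)%N -> xl <= vertex T i <= xr.
Proof.
move=> iN; apply/andP; split; first exact: (@vertex_le 0 i).
by have := @vertex_le i (ncell T); rewrite vertex_ncell iN leqnn => ->.
Qed.

Lemma cell_sub_Omega i : (i < ncell T)%N -> cell T i `<=` Omega xl xr.
Proof.
move=> iN x; rewrite /cell /Omega /= !in_itv/= => /andP[ix xi].
have /andP[lxi _] := vertex_bounds (ltnW iN).
have /andP[_ xir] := vertex_bounds iN.
by rewrite (le_lt_trans lxi ix) (lt_le_trans xi xir).
Qed.

Lemma Omega_cover x : Omega xl xr x ->
  (exists2 i, (i < ncell T)%N & cell T i x) \/
  (exists2 i, (0 < i < ncell T)%N & x = vertex T i).
Proof.
rewrite /Omega /= in_itv/= => /andP[lx xr'].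
suff: forall m, (m <= ncell T)%N -> x < vertex T m ->
    (exists2 i, (i < m)%N & cell T i x) \/
    (exists2 i, (0 < i < m)%N & x = vertex T i).
  by apply => //; rewrite vertex_ncell.
elim=> [|m IH] mN xm; first by move: xm; rewrite vertex0 ltNge ltW.
have [xm'|mx|xm'] := ltgtP x (vertex T m).
- have [[i im ix]|[i /andP[i0 im] ix]] := IH (ltnW mN) xm'.
    by left; exists i => //; rewrite ltnS ltnW.
  by right; exists i => //; rewrite i0 ltnS ltnW.
- by left; exists m => //; rewrite /cell /= in_itv/= mx.
- right; exists m => //; rewrite ltnSn andbT lt0n.
  by apply/eqP => m0; move: lx; rewrite xm' m0 vertex0 ltxx.
Qed.

(** The pieces are restrictions of functions continuous on the whole line, so
that they are bounded on each cell: a function merely continuous on the open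
cells need not be integrable. *)
Definition pwC0 h : Prop :=
  forall i, (i < ncell T)%N ->
    exists2 g : R -> R, continuous g & forall x, cell T i x -> h x = g x.

Lemma pwC0_integrable_cell h i : pwC0 h -> (i < ncell T)%N ->
  mu.-integrable (cell T i) (EFin \o h).
Proof.
move=> Ch iN; have [g cg hg] := Ch i iN.
apply: (@eq_integrable _ _ _ mu (cell T i) _ (EFin \o g)).
- exact: measurable_itv.
- by move=> x /set_mem /hg /= ->.
- exact: continuous_integrable_itvoo.
Qed.

(** The vertices form a null set, so that an integral over the domain splits
over the open cells whatever the values at the vertices are. *)
Lemma pwC0_integral_oc h m : pwC0 h -> (m <= ncell T)%N ->
  mu.-integrable `]xl, vertex T m] (EFin \o h) /\
  \int[mu]_(x in `]xl, vertex T m]) h x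
  = \sum_(i < m) \int[mu]_(x in cell T i) h x.
Proof.
move=> Ch; elim: m => [_|m IH mN].
  rewrite vertex0 big_ord0 set_itv_ge ?bnd_simp ?ltxx//.
  by rewrite Rintegral_set0; split => //; exact: integrable_set0.
have [i1 e1] := IH (ltnW mN).
have xm : xl <= vertex T m by case/andP: (vertex_bounds (ltnW mN)).
have mm : vertex T m <= vertex T m.+1 by rewrite ltW// vertexS_lt.
have icell := pwC0_integrable_cell Ch mN.
have i2 : mu.-integrable `]xl, vertex T m.+1] (EFin \o h).
  by apply: (integrable_itv_cat xm mm i1); exact: integrable_itv_oc.
split => //; rewrite big_ord_recr/= -e1.
have := Rintegral_itvB i2 (_ : (BRight xl <= BRight (vertex T m))%O) _.
rewrite !bnd_simp => /(_ xm mm) /eqP; rewrite subr_eq addrC => /eqP ->.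
by congr (_ + _); rewrite -Rintegral_itv_bndo_bndc.
Qed.

Lemma pwC0_integrable h : pwC0 h -> mu.-integrable (Omega xl xr) (EFin \o h).
Proof.
move=> Ch; have [+ _] := pwC0_integral_oc Ch (leqnn _); rewrite vertex_ncell.
apply: integrableS; [exact: measurable_itv|exact: measurable_itv|].
by rewrite /Omega; apply: subset_itvl; rewrite bnd_simp.
Qed.

Lemma pwC0_integral h : pwC0 h ->
  \int[mu]_(x in Omega xl xr) h x
  = \sum_(i < ncell T) \int[mu]_(x in cell T i) h x.
Proof.
move=> Ch; have [_ <-] := pwC0_integral_oc Ch (leqnn _).
by rewrite vertex_ncell -Rintegral_itv_bndo_bndc//; exact: pwC0_integrable.
Qed.

Lemma pwC0M g h : pwC0 g -> pwC0 h -> pwC0 (fun x => g x * h x).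
Proof.
move=> Cg Ch i iN; have [g' cg gE] := Cg i iN; have [h' ch hE] := Ch i iN.
exists (g' \* h') => [x|x ix]; first exact: (continuousM (cg x) (ch x)).
by rewrite gE// hE.
Qed.

Lemma continuous_pwC0 h : continuous h -> pwC0 h.
Proof. by move=> ch i iN; exists h. Qed.

Lemma pwC0Z b h : pwC0 h -> pwC0 (fun x => b * h x).
Proof. by apply: pwC0M; apply: continuous_pwC0 => x; exact: cvg_cst. Qed.

(** What happens at the vertices is irrelevant to the integral. This disposes of
[grad], whose values at the kinks of a function are meaningless. *)
Lemma eq_pwC0_integral g h :
  (forall i, (i < ncell T)%N -> forall x, cell T i x -> g x = h x) ->
  pwC0 h ->
  \int[mu]_(x in Omega xl xr) g x = \int[mu]_(x in Omega xl xr) h x.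
Proof.
move=> gh Ch; have Cg : pwC0 g.
  move=> i iN; have [h' ch hE] := Ch i iN; exists h' => // x ix.
  by rewrite (gh i iN)// hE.
rewrite !pwC0_integral//; apply: eq_bigr => i _; apply: eq_Rintegral.
by move=> x /set_mem; exact: gh.
Qed.

Lemma pwC0_L2 h : pwC0 h -> L2 (Omega xl xr) h.
Proof.
move=> Ch.
have /integrableP[mh2 ih2] := pwC0_integrable (pwC0M Ch Ch).
have /integrableP[/measurable_EFinP mh _] := pwC0_integrable Ch.
have mhD : measurable_fun setT (h \_ (Omega xl xr)).
  exact/(measurable_restrictT h (measurable_itv _)).
rewrite /L2 inE; apply/andP; split; rewrite inE//=.
rewrite /finite_norm unlock /=; apply: poweR_lty.
rewrite (_ : (fun x => _) = (EFin \o (fun x => `|h x * h x|)) \_ (Omega xl xr)).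
  by rewrite -integral_mkcond.
apply/funext => x; rewrite /= !patchE; case: ifPn => xO /=.
  by rewrite powR_mulrn// normrM expr2.
by rewrite normr0 powR0// pnatr_eq0.
Qed.

End Mesh.

(** * Integration by parts over a mesh *)

Section PiecewiseC1.
Context {R : realType} {xl xr kappa : R} (T : mesh xl xr kappa).
Notation mu := (@lebesgue_measure R).
Implicit Types (v w : R -> R) (V W : nat -> R) (i k : nat).

Lemma continuous_Rintegral_itvoo_cc (a b : R) (g : R -> R) : continuous g ->
  \int[mu]_(x in `]a, b[) g x = \int[mu]_(x in `[a, b]) g x.
Proof.
move=> cg; have ig := continuous_integrable_itvoo a b cg.
rewrite Rintegral_itv_bndo_bndc// Rintegral_itv_obnd_cbnd//.
exact: integrable_itv_oc.
Qed.

Lemma grad_eq_itvoo (a b : R) v w :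
  (forall x, `]a, b[%classic x -> v x = w x) ->
  forall x, `]a, b[%classic x -> grad v x = derive1 w x.
Proof.
move=> vw x xab; rewrite /grad !derive1E; apply: near_eq_derive.
have := near_in_itvoo xab; apply: filterS => y; exact: vw.
Qed.

(** Piecewise C^1 functions whose pieces fit together: [V j] is the common value
of the adjacent pieces at the vertex of index [j]. Recording the values in [V],
rather than requiring [v] to be continuous, covers functions that are continuous
only up to a null set. *)
Definition pwC1 v (V : nat -> R) : Prop :=
  forall i, (i < ncell T)%N -> exists P : R -> R,
    [/\ forall x, derivable P x 1,
        continuous (derive1 P),
        forall x, cell T i x -> v x = P x &
        P (vertex T i) = V i /\ P (vertex T i.+1) = V i.+1].

Lemma pwC1_pwC0 v V : pwC1 v V -> pwC0 T v.
Proof.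
move=> Cv i iN; have [P [dP _ vP _]] := Cv i iN; exists P => // x.
by apply: differentiable_continuous; apply/derivable1_diffP.
Qed.

Lemma pwC1_grad v V : pwC1 v V -> pwC0 T (grad v).
Proof.
move=> Cv i iN; have [P [_ cP vP _]] := Cv i iN; exists (derive1 P) => //.
exact: grad_eq_itvoo.
Qed.

(** On each cell this is the classical formula; the boundary terms telescope
because both neighbours of a vertex contribute the same product of values. *)
Lemma L2prod_by_parts v V w W : pwC1 v V -> pwC1 w W ->
  L2prod (Omega xl xr) v (grad w)
  = V (ncell T) * W (ncell T) - V 0 * W 0 - L2prod (Omega xl xr) (grad v) w.
Proof.
move=> Cv Cw; rewrite /L2prod.
rewrite (pwC0_integral (pwC0M (pwC1_pwC0 Cv) (pwC1_grad Cw))).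
rewrite (pwC0_integral (pwC0M (pwC1_grad Cv) (pwC1_pwC0 Cw))).
have -> : V (ncell T) * W (ncell T) - V 0 * W 0
    = \sum_(i < ncell T) (V i.+1 * W i.+1 - V i * W i).
  by rewrite -(big_mkord xpredT (fun i => V i.+1 * W i.+1 - V i * W i))
             telescope_sumr.
rewrite -sumrB; apply: eq_bigr => -[i iN] _ /=.
have [P [dP cP vP [Pi PSi]]] := Cv i iN.
have [Q [dQ cQ wQ [Qi QSi]]] := Cw i iN.
have cdP : continuous P.
  by move=> x; apply: differentiable_continuous; apply/derivable1_diffP.
have cdQ : continuous Q.
  by move=> x; apply: differentiable_continuous; apply/derivable1_diffP.
have LR (F : R -> R) : (forall x, derivable F x 1) -> continuous F ->
    derivable_oo_LRcontinuous F (vertex T i) (vertex T i.+1).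
  move=> dF cF; split => //.
  - by apply: cvg_at_right_filter; exact: cF.
  - by apply: cvg_at_left_filter; exact: cF.
transitivity (\int[mu]_(x in cell T i) (P x * derive1 Q x)).
  apply: eq_Rintegral => x /set_mem xi.
  by rewrite vP// (grad_eq_itvoo wQ).
transitivity (V i.+1 * W i.+1 - V i * W i
              - \int[mu]_(x in cell T i) (derive1 P x * Q x)); last first.
  congr (_ - _); apply: eq_Rintegral => x /set_mem xi.
  by rewrite wQ// (grad_eq_itvoo vP).
rewrite /cell !continuous_Rintegral_itvoo_cc//; last 2 first.
- by move=> x; exact: (continuousM (cP x) (cdQ x)).
- by move=> x; exact: (continuousM (cdP x) (cQ x)).
rewrite (@Rintegration_by_parts _ P Q (derive1 P) (derive1 Q)).
- by rewrite Pi PSi Qi QSi.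
- exact: vertexS_lt.
- exact: continuous_subspaceT.
- exact: LR.
- by [].
- exact: continuous_subspaceT.
- exact: LR.
- by [].
Qed.

(** A piecewise polynomial with a continuous representative is determined up to
the ends of each cell: there its polynomial pieces take the values of the
representative. *)
Lemma Ppw_representative k v w i : Ppw T k v ->
  {within `[xl, xr], continuous w} ->
  {ae mu, forall x, Omega xl xr x -> v x = w x} ->
  (i < ncell T)%N ->
  exists p : {poly R}, [/\ (size p <= k.+1)%N,
    forall x, cell T i x -> v x = p.[x],
    p.[vertex T i] = w (vertex T i) & p.[vertex T i.+1] = w (vertex T i.+1)].
Proof.
move=> Pv cw vw iN; have [p sp vp] := Pv i iN.
have lti := vertexS_lt iN.
have /andP[lxi _] := vertex_bounds (ltnW iN).
have /andP[_ xir] := vertex_bounds iN.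
have pw : {ae mu, forall x, `]vertex T i, vertex T i.+1[%classic x ->
                            p.[x] = w x}.
  move: vw; apply: filterS; first exact: (ae_filter_ringOfSetsType mu).
  move=> x vwx xi; rewrite -vp// vwx//.
  exact: cell_sub_Omega xi.
have : {within `[vertex T i, vertex T i.+1], continuous w}.
  apply: continuous_subspaceW cw; apply: subset_itv; rewrite bnd_simp//.
case/(continuous_within_itvP _ lti) => _ wi wSi.
have cp : continuous (horner p) by exact: (@continuous_horner R p).
exists p; split; [exact: sp|exact: vp| |].
- apply: (ae_eq_right_limit lti pw) => //.
  by apply: cvg_at_right_filter; exact: cp.
- apply: (ae_eq_left_limit lti pw) => //.
  by apply: cvg_at_left_filter; exact: cp.
Qed.

Lemma pwC1_representative k v w : Ppw T k v ->
  {within `[xl, xr], continuous w} ->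
  {ae mu, forall x, Omega xl xr x -> v x = w x} ->
  pwC1 v (fun i => w (vertex T i)).
Proof.
move=> Pv cw vw i iN.
have [p [_ vp pi pSi]] := Ppw_representative Pv cw vw iN.
exists (horner p); split; [|rewrite -(derivE p)|exact: vp|by []].
- by move=> x; exact: (@derivable_horner R p x).
- exact: (@continuous_horner R p^`()).
Qed.

Lemma Ppw_pwC0 k v : Ppw T k v -> pwC0 T v.
Proof.
move=> Pv i iN; have [p _ vp] := Pv i iN; exists (horner p) => //.
exact: (@continuous_horner R p).
Qed.

Lemma Ppw_leq k l v : (k <= l)%N -> Ppw T k v -> Ppw T l v.
Proof.
move=> kl Pv i iN; have [p sp vp] := Pv i iN; exists p => //.
exact: leq_trans sp _.
Qed.

Lemma L2prodC (D : set R) v w : L2prod D v w = L2prod D w v.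
Proof. by apply: eq_Rintegral => x _; rewrite mulrC. Qed.

Lemma L2prodZ b v w : pwC0 T v -> pwC0 T w ->
  L2prod (Omega xl xr) v (fun x => b * w x) = b * L2prod (Omega xl xr) v w.
Proof.
move=> Cv Cw; rewrite /L2prod -RintegralZl//; last 2 first.
- exact: measurable_itv.
- exact: (pwC0_integrable (pwC0M Cv Cw)).
by apply: eq_Rintegral => x _; rewrite mulrCA.
Qed.

End PiecewiseC1.

(** * Hat functions *)

Section Hat.
Context {R : realType} {xl xr kappa : R} (T : mesh xl xr kappa).
Hypothesis hx : xl < xr.
Notation mu := (@lebesgue_measure R).
Implicit Types (f h v w : R -> R) (i j k : nat).

Lemma closure_Omega : closure (Omega xl xr) = `[xl, xr]%classic.
Proof.
apply/seteqP; split; first exact: itv_closure.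
move=> x /=; rewrite in_itv/= => /andP[].
rewrite le_eqVlt => /predU1P[<- _|lx].
  move=> B xB.
  have xB' : \forall y \near xl^'+, B y by exact: cvg_within xB.
  have xlt : \forall y \near xl^'+, y < xr by exact: nbhs_right_lt.
  have xgt : \forall y \near xl^'+, xl < y by exact: nbhs_right_gt.
  have [y [[By yr] ly]] := filter_ex (filterI (filterI xB' xlt) xgt).
  by exists y; split => //; rewrite /Omega /= in_itv/= ly.
rewrite le_eqVlt => /predU1P[->|xr'].
  move=> B xB.
  have xB' : \forall y \near xr^'-, B y by exact: cvg_within xB.
  have xlt : \forall y \near xr^'-, y < xr by exact: nbhs_left_lt.
  have xgt : \forall y \near xr^'-, xl < y by exact: nbhs_left_gt.
  have [y [[By yr] ly]] := filter_ex (filterI (filterI xB' xlt) xgt).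
  by exists y; split => //; rewrite /Omega /= in_itv/= ly.
by apply: subset_closure; rewrite /Omega /= in_itv/= lx.
Qed.

Lemma patch_sub_Omega i : (i <= ncell T)%N -> vertex_patch T i `<=` Omega xl xr.
Proof.
move=> iN; have /andP[l _] := vertex_bounds (leq_trans (leq_pred i) iN).
have /andP[_ r] := vertex_bounds (geq_minr i.+1 (ncell T)).
by apply: subset_itv; rewrite bnd_simp.
Qed.

Lemma cell_sub_patch i j : (i <= ncell T)%N -> (j < ncell T)%N ->
  (j == i) || (j.+1 == i) -> cell T j `<=` vertex_patch T i.
Proof.
move=> iN jN ji; apply: subset_itv; rewrite bnd_simp.
- apply: vertex_le.
  by case/orP: ji => /eqP <- /=; rewrite ?leq_pred ?leqnn ltnW.
- apply: vertex_le; rewrite leq_min jN geq_minr !andbT.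
  by case/orP: ji => /eqP <-; rewrite ?leqnn ?leqnSn.
Qed.

Lemma vertex_in_patch i : (0 < i < ncell T)%N -> vertex_patch T i (vertex T i).
Proof.
case/andP=> i0 iN; rewrite /vertex_patch (minn_idPl iN) /= in_itv/=.
by rewrite vertexS_lt// andbT vertex_lt// prednK// leqnn ltnW.
Qed.

Lemma Rintegral_patch i h : (i <= ncell T)%N ->
  \int[mu]_(x in vertex_patch T i) h x
  = \int[mu]_(x in Omega xl xr) (h \_ (vertex_patch T i)) x.
Proof.
move=> iN; rewrite -Rintegral_mkcondr; congr (Rintegral _ _ _).
by rewrite setIC; apply/esym/setIidl; exact: patch_sub_Omega.
Qed.

(** The support is closed and contained in the open domain. *)
Lemma C1c_endpoints0 (phi : R -> R) : C1c (Omega xl xr) phi ->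
  phi xl = 0 /\ phi xr = 0.
Proof.
case=> _ _ _ sub; split; apply: contrapT => /eqP phi0.
- have /sub : closure [set x | phi x != 0] xl by exact: subset_closure.
  by rewrite /Omega /= in_itv/= ltxx.
- have /sub : closure [set x | phi x != 0] xr by exact: subset_closure.
  by rewrite /Omega /= in_itv/= ltxx andbF.
Qed.

Lemma C1c_pwC1 (phi : R -> R) : C1c (Omega xl xr) phi ->
  pwC1 T phi (fun j => phi (vertex T j)).
Proof. by case=> dphi cphi _ _ j jN; exists phi. Qed.

Section Fixed.
Variables (i : nat) (psi : R -> R).
Hypotheses (iN : (i <= ncell T)%N) (hpsi : is_hat T i psi).

Lemma hat_pwC1 : pwC1 T psi (fun j => psi (vertex T j)).
Proof.
have [cpsi Ppsi _] := hpsi; apply: pwC1_representative Ppsi cpsi _.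
exact: aeW.
Qed.

(** A cell outside the patch has two end points at which the hat function is 0,
and an affine function with two zeros is 0. *)
Lemma hat_eq0_cell j : (j < ncell T)%N -> ~ cell T j `<=` vertex_patch T i ->
  forall x, cell T j x -> psi x = 0.
Proof.
move=> jN jp; have [cpsi Ppsi psiV] := hpsi.
have /norP[ji jSi] : ~~ ((j == i) || (j.+1 == i)).
  by apply/negP => ji; apply: jp; exact: cell_sub_patch.
have [|p [sp psip p0 p1]] := Ppw_representative Ppsi cpsi _ jN.
  exact: aeW.
suff p_eq0 : p = 0 by move=> x /psip ->; rewrite p_eq0 horner0.
move: p0 p1; rewrite !psiV ?(ltnW jN)// (negPf ji) (negPf jSi) => p0 p1.
apply: (@roots_geq_poly_eq0 _ _ [:: vertex T j; vertex T j.+1]) => //=.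
- by rewrite /root p0 p1 eqxx.
- by rewrite inE lt_eqF ?vertexS_lt.
Qed.

Lemma hat_eq0_off_patch x : Omega xl xr x -> ~ vertex_patch T i x -> psi x = 0.
Proof.
have [_ _ psiV] := hpsi.
move=> /(Omega_cover T) [[j jN jx]|[j jN ->]] xp.
- by apply: (hat_eq0_cell jN) (jx) => /(_ _ jx).
- have [j0 jN'] := andP jN.
  rewrite (psiV _ (ltnW jN')); case: eqP => // ji.
  by case: xp; rewrite -ji; exact: vertex_in_patch.
Qed.

Lemma L2prod_hat_patch f :
  L2prod (Omega xl xr) f psi = L2prod (vertex_patch T i) f psi.
Proof.
rewrite /L2prod Rintegral_patch//; apply: eq_Rintegral => x /set_mem xO.
rewrite patchE; case: ifPn => // /negP xp.
by rewrite hat_eq0_off_patch ?mulr0// => /mem_set.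
Qed.

Lemma L2prod_grad_hat_patch u b : pwC0 T u ->
  L2prod (Omega xl xr) u (fun x => b * grad psi x)
  = L2prod (vertex_patch T i) u (fun x => b * grad psi x).
Proof.
move=> Cu; rewrite /L2prod Rintegral_patch//; apply/esym.
apply: eq_pwC0_integral; last first.
  exact: (pwC0M Cu (pwC0Z _ (pwC1_grad hat_pwC1))).
move=> j jN x jx; rewrite patchE; case: ifPn => // /negP xp.
rewrite (@grad_eq_itvoo _ _ _ psi (cst 0) _ x jx) ?derive1_cst ?mulr0//.
apply: (hat_eq0_cell jN) => /(_ _ jx) xp'; apply: xp.
exact: mem_set.
Qed.

(** The elementwise derivative is the weak one: no boundary term survives, since
the hat function is continuous and the test functions vanish at the end points
of the domain. *)
Lemma hat_H1 : H1 (Omega xl xr) psi.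
Proof.
have Cpsi := hat_pwC1; split; first exact: (pwC0_L2 (pwC1_pwC0 Cpsi)).
exists (grad psi); first exact: (pwC0_L2 (pwC1_grad Cpsi)).
move=> phi Cphi; rewrite (L2prod_by_parts Cpsi (C1c_pwC1 Cphi)).
have [pl pr] := C1c_endpoints0 Cphi.
by rewrite vertex_ncell vertex0 pl pr !mulr0 subrr sub0r.
Qed.

Lemma hat_jump j : Vint T j -> jump psi (vertex T j) = 0.
Proof.
move=> /andP[j0 jN]; have [cpsi _ _] := hpsi.
have jO : vertex T j \in `]xl, xr[.
  rewrite in_itv/=; apply/andP; split.
    by have := @vertex_lt _ _ _ _ T 0 j; rewrite vertex0 j0 ltnW// => ->.
  have := @vertex_lt _ _ _ _ T j (ncell T).
  by rewrite vertex_ncell jN leqnn => ->.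
have cj := within_continuous_continuous hx cpsi jO.
rewrite /jump /trace_right /trace_left.
rewrite (cvg_lim _ (cvg_at_right_filter cj))//.
by rewrite (cvg_lim _ (cvg_at_left_filter cj))// subrr.
Qed.

Lemma hat_trace_bnd x : x = xl \/ x = xr -> trace_bnd xl psi x = psi x.
Proof.
have [cpsi _ _] := hpsi.
have [_ cl cr] := (continuous_within_itvP _ hx).1 cpsi.
rewrite /trace_bnd; case=> ->; first by rewrite eqxx; exact: cvg_lim.
by rewrite gt_eqF//; exact: cvg_lim.
Qed.

Variable b : R.
Hypothesis hi : Vint T i \/ Vin T b i.

(** An interior vertex is no end point, and the sign of b n separates inflow
from outflow. *)
Lemma vertex_not_outflow : ~ outflow xl xr b (vertex T i).
Proof.
case: hi => [/andP[i0 iN']|[_ [_ bn0]]] [xi bn].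
  have lt1 := @vertex_lt _ _ _ _ T 0 i.
  have lt2 := @vertex_lt _ _ _ _ T i (ncell T).
  move: lt1 lt2; rewrite vertex0 vertex_ncell i0 iN iN' leqnn.
  by case: xi => -> => [/(_ isT)|_ /(_ isT)]; rewrite ltxx.
by have := lt_trans bn bn0; rewrite ltxx.
Qed.

Lemma hat_outflow0 c : outflow xl xr b c -> psi c = 0.
Proof.
have [_ _ psiV] := hpsi => oc.
have [j jN cE] : exists2 j, (j <= ncell T)%N & c = vertex T j.
  case: oc.1 => ->; first by exists 0%N.
  by exists (ncell T); rewrite ?vertex_ncell.
move: oc; rewrite cE psiV//; case: eqP => // -> /vertex_not_outflow.
by [].
Qed.

Lemma hat_H1p : H1p xl xr b psi.
Proof.
split; first exact: hat_H1.
have [cpsi _ _] := hpsi; exists psi; split.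
- by rewrite closure_Omega.
- exact: aeW.
- exact: hat_outflow0.
Qed.

End Fixed.
End Hat.

(** * Orthogonality for each of the methods *)

Section Residual.
Context {R : realType} {xl xr kappa : R} (T : mesh xl xr kappa).
Hypothesis hx : xl < xr.
Variables (b : R) (f u : R -> R) (i k : nat) (psi : R -> R).
Hypotheses (hb : b != 0) (iN : (i <= ncell T)%N) (hpsi : is_hat T i psi).
Hypothesis hi : Vint T i \/ Vin T b i.

Local Notation residual_zero :=
  (L2prod (Omega xl xr) u (fun x => b * grad psi x)
   = - L2prod (Omega xl xr) f psi).

Lemma inflow_or_outflow c : c = xl \/ c = xr ->
  inflow xl xr b c \/ outflow xl xr b c.
Proof.
move=> ce; have : b * unit_normal xl c != 0.
  by rewrite mulf_neq0// /unit_normal; case: ifP => _;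
    rewrite ?oppr_eq0 oner_neq0.
by rewrite neq_lt => /orP[|]; [left|right].
Qed.

(** Integration by parts moves the derivative from [u] to the hat function; the
hypothesis on [k] makes the hat function an admissible test function. *)
Lemma PG1_residual : (2 <= k)%N -> PG1 T k b f u -> residual_zero.
Proof.
move=> k2 [[_ [w [cw uw w0]]] Pu uE]; have [_ Ppsi _] := hpsi.
rewrite closure_Omega// in cw.
have Cu := pwC1_representative Pu cw uw.
have Cpsi := hat_pwC1 hpsi.
have hat_w c : c = xl \/ c = xr -> psi c * w c = 0.
  move=> /inflow_or_outflow[/w0 ->|/(hat_outflow0 iN hpsi hi) ->].
  - by rewrite mulr0.
  - by rewrite mul0r.
have <- : L2prod (Omega xl xr) psi (fun x => b * grad u x)
          = L2prod (Omega xl xr) f psi.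
  rewrite L2prodC uE//; apply: Ppw_leq Ppsi.
  by case: (k) k2 => // -[].
rewrite (L2prodZ _ (pwC1_pwC0 Cpsi) (pwC1_grad Cu)).
rewrite (L2prodZ _ (pwC1_pwC0 Cu) (pwC1_grad Cpsi)).
rewrite (L2prod_by_parts Cpsi Cu) vertex_ncell vertex0.
rewrite !hat_w; [|by left|by right].
by rewrite subrr sub0r mulrN opprK L2prodC.
Qed.

(** The hat function is an admissible test function for every degree. *)
Lemma PG2_residual : PG2 T k b f u -> residual_zero.
Proof.
move=> [_ uE]; have [_ Ppsi _] := hpsi.
rewrite -uE ?opprK//; first exact: (hat_H1p hx iN hpsi hi).
exact: Ppw_leq Ppsi.
Qed.

(** Only the volume term of the bilinear form survives. *)
Lemma dG_residual : (1 <= k)%N -> dG T k b f u -> residual_zero.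
Proof.
move=> k1 [Pu uE]; have [_ Ppsi _] := hpsi.
rewrite -uE; last exact: Ppw_leq Ppsi.
(* The two interface sums carry the jump of psi, which is 0 by continuity. *)
rewrite /Bh [X in _ - X]big1 ?subr0; last first.
  by move=> j /asboolP /(hat_jump hx hpsi) ->; rewrite mulr0.
rewrite [X in _ + X + _]big1 ?addr0; last first.
  by move=> j /asboolP /(hat_jump hx hpsi) ->; rewrite mulr0.
(* Boundary: the upwind factor is 0 at the inflow, psi is 0 at the outflow. *)
rewrite [X in _ + X]big1 ?addr0 ?opprK; last first.
  move=> j /asboolP jb.
  have je : vertex T j = xl \/ vertex T j = xr.
    by case: jb => [[_ [je _]]|[_ [je _]]].
  rewrite (hat_trace_bnd hx hpsi je); case: jb => -[_ jb].
    by rewrite max_r ?ltW ?mul0r// jb.2.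
  by rewrite (hat_outflow0 iN hpsi hi jb) mulr0.
have Cgrad := pwC1_grad (hat_pwC1 hpsi).
exact: (pwC0_integral (pwC0M (Ppw_pwC0 Pu) (pwC0Z _ Cgrad))).
Qed.

End Residual.

Theorem lemma4p4 (R : realType) (xl xr : R) (hx : xl < xr)
  (b : R) (hb : b != 0) (f : R -> R) (hf : L2 (Omega xl xr) f)
  (kappa : R) (T : mesh xl xr kappa) (k : nat) (u : R -> R)
  (hu : [\/ (2 <= k)%N /\ PG1 T k b f u,
            PG2 T k b f u |
            (1 <= k)%N /\ dG T k b f u])
  (i : nat) (hi : Vint T i \/ Vin T b i)
  (psi : R -> R) (hpsi : is_hat T i psi) :
  residual xl xr b f u psi
  = L2prod (vertex_patch T i) f psi
    + L2prod (vertex_patch T i) u (fun x => b * grad psi x)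
  /\ L2prod (vertex_patch T i) f psi
     + L2prod (vertex_patch T i) u (fun x => b * grad psi x) = 0.
Proof.
have iN : (i <= ncell T)%N by case: hi => [/andP[_ /ltnW]|[]].
have Cu : pwC0 T u.
  by case: hu => [[_ [_ Pu _]]|[Pu _]|[_ [Pu _]]]; exact: Ppw_pwC0 Pu.
have residual0 : L2prod (Omega xl xr) u (fun x => b * grad psi x)
               = - L2prod (Omega xl xr) f psi.
  case: hu => [[k2 hu']|hu'|[k1 hu']].
  - exact: (PG1_residual hx hb iN hpsi hi k2 hu').
  - exact: (PG2_residual hx iN hpsi hi hu').
  - exact: (dG_residual hx iN hpsi hi k1 hu').
rewrite /residual -(L2prod_hat_patch iN hpsi).
by rewrite -(L2prod_grad_hat_patch iN hpsi)// residual0 subrr.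
Qed.
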